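(* Let $A$ be a finitely $\boldsymbol{\sigma}$-presented étale difference algebra over a difference field $k$. Then $\mathrm{Spec}(A)$ has finitely many $\boldsymbol{\sigma}$-connected components.
   Context: A difference ring is a commutative unital ring with an endomorphism $\sigma$; a difference field is a difference ring that is a field; $\lfloor R\rfloor$ is the underlying ring. A (difference) $k$-algebra is a difference ring $A$ with a difference ring morphism $k\to A$. A cocorrespondence $A_0\xrightarrow{p}C_0\xleftarrow{s}A_0$ of $\lfloor k\rfloor$-algebras consists of a $\lfloor k\rfloor$-algebra homomorphism $p$ and a ring homomorphism $s$ with $s(\lambda a)=\sigma_k(\lambda)s(a)$ for $\lambda\in k$. Its directly presented $k$-algebra $\lceil A_0;C_0|^k$ is the $k$-algebra representing the functor $B\mapsto\{c\in\lfloor k\rfloor\text{-}\mathbf{Alg}(C_0,\lfloor B\rfloor):\sigma_B\circ c\circ p=c\circ s\}$ on $k$-algebras. A $k$-algebra $A$ is finitely $\boldsymbol{\sigma}$-presented étale if $A\simeq\lceil A_0;C_0|^k$ for some cocorrespondence of (finite-dimensional) étale $\lfloor k\rfloor$-algebras. $\mathrm{Spec}(A)$ denotes the topological space $\mathrm{Spec}(\lfloor A\rfloor)$ (Zariski topology) with the continuous self-map $\mathfrak{p}\mapsto\sigma_A^{-1}(\mathfrak{p})$. For a topological space $X$ with continuous self-map $\sigma_X$, the $\boldsymbol{\sigma}$-topology on $X$ is the topology whose closed sets are the closed subsets $Z$ of $X$ that are $\sigma_X$-stable ($\sigma_X(Z)\subseteq Z$); the $\boldsymbol{\sigma}$-connected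 components of $X$ are its connected components in the $\boldsymbol{\sigma}$-topology. *)

(* Defs.v *)
From HB Require Import structures.
From mathcomp Require Import all_boot all_order all_algebra all_field.
From mathcomp Require Import all_classical topology.

Set Implicit Arguments.
Unset Strict Implicit.
Unset Printing Implicit Defensive.

Import GRing.Theory.

Local Open Scope classical_set_scope.
Local Open Scope ring_scope.

(* All rings and algebras below are based on comPzRingType rather than
   comNzRingType, so that the zero ring is allowed. *)

HB.mixin Record hasDifference R & GRing.ComPzRing R := {
  difference_subdef : {rmorphism R -> R}
}.

#[short(type="diffRingType")]
HB.structure Definition DiffRing := {R of GRing.ComPzRing R & hasDifference R}.

#[short(type="diffFieldType")]
HB.structure Definition DiffField := {R of GRing.Field R & hasDifference R}.

Definition sigma {R : diffRingType} : {rmorphism R -> R} := difference_subdef.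

(* Algebras over the ring underlying k.  The library's comAlgType excludes the
   zero ring, so an algebra is given by its structure morphism. *)
Record algebra (k : comPzRingType) := Algebra {
  algebra_sort :> comPzRingType;
  algebra_map : {rmorphism k -> algebra_sort}
}.

Record diffAlgebra (k : diffRingType) := DiffAlgebra {
  diffAlgebra_sort :> diffRingType;
  diffAlgebra_map : {rmorphism k -> diffAlgebra_sort};
  _ : forall x : k, sigma (diffAlgebra_map x) = diffAlgebra_map (sigma x)
}.

Definition underlying (k : diffRingType) (A : diffAlgebra k) : algebra k :=
  Algebra (diffAlgebra_map A).

Record algHom (k : comPzRingType) (A B : algebra k) := AlgHom {
  algHom_fun :> {rmorphism A -> B};
  algHomP : forall x : k, algHom_fun (algebra_map A x) = algebra_map B x
}.

Record diffAlgHom (k : diffRingType) (A B : diffAlgebra k) := DiffAlgHom {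
  diffAlgHom_alg :> algHom (underlying A) (underlying B);
  diffAlgHomP :
    forall a : A, diffAlgHom_alg (sigma a) = sigma (diffAlgHom_alg a : B)
}.

Lemma algHom_comp_subproof (k : comPzRingType) (A B C : algebra k)
    (g : algHom B C) (f : algHom A B) (x : k) :
  (g \o f) (algebra_map A x) = algebra_map C x.
Proof. by rewrite /= !algHomP. Qed.

Definition algHom_comp (k : comPzRingType) (A B C : algebra k)
    (g : algHom B C) (f : algHom A B) : algHom A C :=
  @AlgHom k A C (g \o f : {rmorphism A -> C}) (algHom_comp_subproof g f).

Lemma diffAlgHom_comp_subproof (k : diffRingType) (A B C : diffAlgebra k)
    (g : diffAlgHom B C) (f : diffAlgHom A B) (a : A) :
  algHom_comp g f (sigma a) = sigma (algHom_comp g f a : C).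
Proof. by rewrite /= !diffAlgHomP. Qed.

Definition diffAlgHom_comp (k : diffRingType) (A B C : diffAlgebra k)
    (g : diffAlgHom B C) (f : diffAlgHom A B) : diffAlgHom A C :=
  DiffAlgHom (diffAlgHom_comp_subproof g f).

(* Finite étale algebras over a field: the algebras isomorphic to a finite
   product of finite separable field extensions. The empty product, i.e. the
   zero algebra, is included. *)
Definition finite_etale (k : fieldType) (E : algebra k) : Prop :=
  exists (n : nat) (L : 'I_n -> fieldExtType k)
         (f : forall i, {rmorphism E -> L i}),
    [/\ (forall i, separable 1%AS {:L i}),
        (forall i (x : k), f i (algebra_map E x) = x%:A)
      & bijective (fun (e : E) (i : 'I_n) => f i e)].

Record cocorrespondence (k : diffRingType) (A0 C0 : algebra k) :=
  Cocorrespondence {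
    coc_p : algHom A0 C0;
    coc_s : {rmorphism A0 -> C0};
    coc_sP : forall (x : k) (a : A0),
      coc_s (algebra_map A0 x * a) = algebra_map C0 (sigma x) * coc_s a
  }.

Section DirectPresentation.
Variables (k : diffRingType) (A0 C0 : algebra k) (X : cocorrespondence A0 C0).

(* The value at B of the functor represented by the directly presented
   algebra. *)
Record coc_points (B : diffAlgebra k) := CocPoint {
  coc_point_hom :> algHom C0 (underlying B);
  coc_pointP : forall a : A0,
    sigma (coc_point_hom (coc_p X a) : B) = coc_point_hom (coc_s X a)
}.

Lemma coc_points_map_subproof (B B' : diffAlgebra k) (g : diffAlgHom B B')
    (c : coc_points B) (a : A0) :
  sigma (algHom_comp g c (coc_p X a) : B') = algHom_comp g c (coc_s X a).
Proof. by rewrite /= -coc_pointP diffAlgHomP. Qed.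

Definition coc_points_map (B B' : diffAlgebra k) (g : diffAlgHom B B')
    (c : coc_points B) : coc_points B' :=
  CocPoint (coc_points_map_subproof g c).

Definition directly_presented_by (A : diffAlgebra k) : Prop :=
  exists phi : forall B : diffAlgebra k, diffAlgHom A B -> coc_points B,
    (forall B, bijective (phi B)) /\
    (forall (B B' : diffAlgebra k) (g : diffAlgHom B B') (f : diffAlgHom A B),
       phi B' (diffAlgHom_comp g f) = coc_points_map g (phi B f)).

End DirectPresentation.

Definition finitely_sigma_presented_etale (k : diffFieldType)
    (A : diffAlgebra k) : Prop :=
  exists (A0 C0 : algebra k) (X : cocorrespondence A0 C0),
    [/\ finite_etale A0, finite_etale C0 & directly_presented_by X A].

(* The library's prime_idealr is only available over nonzero rings. *)
Definition prime_ideal (R : comPzRingType) (I : set R) : Prop :=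
  [/\ I 0, forall x y, I x -> I y -> I (x + y), forall a x, I x -> I (a * x),
      ~ I 1 & forall x y, I (x * y) -> I x \/ I y].

Record Spec (R : comPzRingType) := MkSpec {
  Spec_set : set R;
  SpecP : prime_ideal Spec_set
}.

HB.instance Definition _ (R : comPzRingType) := gen_eqMixin (Spec R).
HB.instance Definition _ (R : comPzRingType) := gen_choiceMixin (Spec R).

Section Zariski.
Variable R : comPzRingType.

Definition zero_locus (S : set R) : set (Spec R) := [set I | S `<=` Spec_set I].

Definition zariski_open (U : set (Spec R)) : Prop :=
  exists S : set R, ~` U = zero_locus S.

Lemma zariski_openT : zariski_open setT.
Proof.
exists setT; rewrite setCT; apply/seteqP; split => // I /= sI.
by have [_ _ _ I1 _] := SpecP I; apply: I1; apply: sI.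
Qed.

Lemma zariski_openI : setI_closed zariski_open.
Proof.
move=> U V [S US] [T VT]; exists [set x * y | x in S & y in T].
rewrite setCI US VT; apply/seteqP; split => I /=.
  have [_ _ IM _ _] := SpecP I.
  move=> [SI|TI] _ [x Sx [y Ty <-]]; last by apply/IM/TI.
  by rewrite mulrC; apply/IM/SI.
move=> STI; have [?|/existsNP[x /not_implyP[Sx nIx]]] := pselect (S `<=` Spec_set I).
  by left.
right=> y Ty; have [_ _ _ _ Ip] := SpecP I.
by have [//|] : Spec_set I x \/ Spec_set I y by apply/Ip/STI; exists x => //; exists y.
Qed.

Lemma zariski_open_bigU (J : Type) (U : J -> set (Spec R)) :
  (forall j, zariski_open (U j)) -> zariski_open (\bigcup_j U j).
Proof.
move=> /choice[S US]; exists (\bigcup_j S j); rewrite setC_bigcup.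
apply/seteqP; split => I /=.
  by move=> UI x [j _ Sx]; have := UI j Logic.I; rewrite US; apply.
by move=> SI j _; rewrite US => x Sx; apply: SI; exists j.
Qed.

HB.instance Definition _ := isOpenTopological.Build (Spec R)
  zariski_openT zariski_openI zariski_open_bigU.

End Zariski.

Lemma Spec_sigma_subproof (A : diffRingType) (I : Spec A) :
  prime_ideal (@sigma A @^-1` Spec_set I).
Proof.
have [I0 ID IM I1 Ip] := SpecP I; split=> /=.
- by rewrite rmorph0.
- by move=> x y; rewrite rmorphD; apply: ID.
- by move=> a x; rewrite rmorphM; apply: IM.
- by rewrite rmorph1.
- by move=> x y; rewrite rmorphM; apply: Ip.
Qed.

Definition Spec_sigma (A : diffRingType) (I : Spec A) : Spec A :=
  MkSpec (Spec_sigma_subproof I).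

Lemma Spec_sigma_continuous (A : diffRingType) : continuous (@Spec_sigma A).
Proof.
apply/continuousP => U [S US]; exists [set sigma x | x in S].
apply/seteqP; split => I /=.
  move=> nU _ [x Sx <-].
  have : (~` U) (Spec_sigma I) by [].
  by rewrite US; apply.
move=> SI; change ((~` U) (Spec_sigma I)).
by rewrite US => x Sx; apply: SI; exists x.
Qed.

(* sigma_space f is X endowed with the sigma-topology of the self-map f. *)
Definition sigma_space (X : topologicalType) (f : X -> X) : Type := X.

HB.instance Definition _ (X : topologicalType) (f : X -> X) :=
  Choice.copy (sigma_space f) X.

Section SigmaTopology.
Variables (X : topologicalType) (f : X -> X).

Definition sigma_closed (Z : set X) : Prop := closed Z /\ f @` Z `<=` Z.

Definition sigma_open (U : set (sigma_space f)) : Prop :=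
  sigma_closed (~` U : set X).

Lemma sigma_openT : sigma_open setT.
Proof.
by rewrite /sigma_open setCT; split; [exact: closed0 | rewrite image_set0].
Qed.

Lemma sigma_openI : setI_closed sigma_open.
Proof.
move=> U V [cU sU] [cV sV]; rewrite /sigma_open setCI; split.
  exact: closedU.
by rewrite image_setU; apply: setUSS.
Qed.

Lemma sigma_open_bigU (J : Type) (U : J -> set (sigma_space f)) :
  (forall j, sigma_open (U j)) -> sigma_open (\bigcup_j U j).
Proof.
move=> oU; rewrite /sigma_open setC_bigcup; split.
  by apply: closed_bigI => j _; have [] := oU j.
move=> _ [x xU <-] j _; have [_] := oU j; apply; exists x => //.
exact: xU.
Qed.

HB.instance Definition _ := isOpenTopological.Build (sigma_space f)
  sigma_openT sigma_openI sigma_open_bigU.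

Lemma closed_sigma_spaceE (Z : set X) :
  closed (Z : set (sigma_space f)) <-> sigma_closed Z.
Proof.
rewrite -openC; change (sigma_open (~` Z) <-> sigma_closed Z).
by rewrite /sigma_open setCK.
Qed.

Definition sigma_components : set (set X) :=
  range (connected_component [set: sigma_space f]).

End SigmaTopology.

(* Main.v *)
Require Import Defs.
From HB Require Import structures.
From mathcomp Require Import all_boot all_order all_algebra all_field.
From mathcomp Require Import all_classical topology ring.

(** Write [c : C0 -> A] for the universal point of the direct presentation of
[A]. A subset of Spec A that is clopen for the sigma-topology is a Zariski
clopen subset [Z] such that [Z] and its complement are both stable; such a [Z]
is the zero locus of an idempotent [e], unique because idempotents with the
same zero locus are equal, and stability says exactly that [sigma e = e]
([sigma_clopen_zero_locus]). A space with finitely many clopen subsets has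
finitely many connected components ([finite_clopen_components]), so it is
enough to bound the number of idempotents of [A] fixed by sigma.

Geometrically, a point of [A] is an infinite path in a finite directed graph
whose edges are the points of [C0] and whose vertices are those of [A0], sigma
being the shift. A shift-invariant clopen condition depends on the first [N]
edges only, for some [N]. If a path satisfying it and a path violating it go
through the same edge, the first one after [N] steps and the second one at the
start, then the path that follows the first up to that edge and the second from
there on must both satisfy and violate it. The condition is therefore
determined by a set of edges.

Over a base field that is not separably closed, concatenating paths means
forming a composite of two extensions of the residue field of the common edge.
Let [eps] be an idempotent of [C0] whose ideal is a field, and [e] a fixed
idempotent of [A] in the subring generated by [k] and the [sigma^m (c C0)] for
[m <= N]. If neither [e * sigma^N (c eps)] nor [(1 - e) * c eps] vanishes, then
[amalgamation] provides a nonzero ring [R] and morphisms [f g : A -> R] with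
[f (sigma^N (c x)) = g (c x)], [f e = 1] and [g (1 - e) = 1]. The sequence of
the [f (sigma^m (c x))] for [m <= N], continued by the [g (sigma^m (c x))], is
a point of the difference algebra of sequences in [R] with the shift. By the
universal property it comes from a map [h : A -> R] that agrees with [f] on [e]
and with [g] after [sigma^N] ([gluing]). Since [1 - e] is fixed, both [h e] and
[h (1 - e)] are [1], which is absurd. Hence [sigma^N (c eps)] is annihilated by
[e] or by [1 - e]; as the identity of [C0] is a finite sum of such [eps], [e] is
[sigma^N] of the image of a partial sum, and a fixed element is determined by
that partial sum, whatever [N] is. *)

Set Implicit Arguments.
Unset Strict Implicit.
Unset Printing Implicit Defensive.

Import GRing.Theory.

Local Open Scope classical_set_scope.
Local Open Scope ring_scope.

(** * Maximal submodules *)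

Definition submodule (C B : comPzRingType) (b : C -> B) (H : set B) : Prop :=
  [/\ H 0, forall x y, H x -> H y -> H (x + y)
    & forall c x, H x -> H (b c * x)].

(** A submodule that is maximal among those avoiding [D] can only be enlarged by
meeting [D]. For ideals avoiding the powers of an element this produces prime
ideals; for subspaces avoiding a nonzero vector it produces a complement of the
line that this vector spans, hence a linear form. *)
Lemma maximal_submodule (C B : comPzRingType) (b : {rmorphism C -> B})
    (H D : set B) :
  submodule b H -> H `&` D = set0 ->
  exists M, [/\ submodule b M, H `<=` M, M `&` D = set0
    & forall y, ~ M y -> exists c h, M h /\ D (h + b c * y)].
Proof.
move=> [H0 HD HM] HD0.
pose P X := submodule b (X `|` H) /\ (X `|` H) `&` D = set0.
(* Adjoining [H] makes the union of the empty chain admissible. *)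
have [F FP Ftot|X [[[X0 XD XM] XD0] Xmax]] := @Zorn_bigcup B P.
- split.
  + have UF X : F X -> X `|` H `<=` \bigcup_(W in F) W `|` H.
      by move=> FX x [Xx|Hx]; [left; exists X|right].
    split; first by right.
    * move=> x y [[X FX Xx]|Hx] [[Y FY Yy]|Hy].
      - have [XY|YX] := Ftot _ _ FX FY.
          by have [[_ YD _] _] := FP _ FY; apply: UF FY _ _;
            apply: YD; left => //; apply: XY.
        by have [[_ XD _] _] := FP _ FX; apply: UF FX _ _;
          apply: XD; left => //; apply: YX.
      - by have [[_ XD _] _] := FP _ FX; apply: UF FX _ _;
          apply: XD; [left|right].
      - by have [[_ YD _] _] := FP _ FY; apply: UF FY _ _;
          apply: YD; [right|left].
      - by right; apply: HD.
    * move=> c x [[X FX Xx]|Hx]; last by right; apply: HM.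
      by have [[_ _ XM] _] := FP _ FX; apply: UF FX _ _; apply: XM; left.
  + rewrite -subset0 => x [[[X FX Xx]|Hx] Dx]; last by rewrite -HD0.
    by have [_ <-] := FP _ FX; split => //; left.
- set M := X `|` H in X0 XD XM XD0; exists M; split => //; first by right.
  move=> y My; apply: contrapT => nD.
  pose Y := [set h + b c * y | h in M & c in [set: C]].
  have MY : M `<=` Y.
    by move=> h Mh; exists h => //; exists 0 => //; rewrite rmorph0 mul0r addr0.
  have Yy : Y y by exists 0 => //; exists 1 => //; rewrite rmorph1 mul1r add0r.
  have YH : Y `|` H = Y.
    by apply/setUidPl => x Hx; apply: MY; right.
  apply: (Xmax Y).
    split; first by move=> x Xx; apply: MY; left.
    by move=> /(_ y Yy) Xy; apply: My; left.
  split; rewrite YH.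
    split; first exact: MY.
    - move=> _ _ [h Mh [c _ <-]] [h' Mh' [c' _ <-]].
      exists (h + h'); first exact: XD.
      by exists (c + c') => //; rewrite rmorphD; ring.
    - move=> d _ [h Mh [c _ <-]]; exists (b d * h); first exact: XM.
      by exists (d * c) => //; rewrite rmorphM; ring.
  rewrite -subset0 => _ [[h Mh [c _ <-]] Dh].
  by apply: nD; exists c, h.
Qed.

(** * Clopen subsets of the spectrum *)

Section Spectrum.
Variable R : comPzRingType.
Implicit Types (I : set R) (P : Spec R) (Z : set (Spec R)).

Lemma prime_avoiding_powers I (x : R) :
  submodule idfun I -> (forall n, ~ I (x ^+ n)) ->
  exists P, I `<=` Spec_set P /\ ~ Spec_set P x.
Proof.
move=> idI Ix; pose D := [set x ^+ n | n in [set: nat]].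
have [|M [[M0 MD MM] IM MD0 Mmax]] := @maximal_submodule R R idfun I D idI.
  by rewrite -subset0 => y [Iy [n _ yE]]; apply: (Ix n); rewrite yE.
have nMD y : M y -> ~ D y by move=> My Dy; rewrite -[False]/(set0 y) -MD0.
have MP : prime_ideal M.
  split => //; first by move=> M1; apply: (nMD _ M1); exists 0%N.
  move=> y z Myz; apply: contrapT => /not_orP[/Mmax + /Mmax].
  move=> [c [h [Mh [n _ hn]]]] [d [g [Mg [m _ gm]]]].
  apply: (nMD (x ^+ (n + m))); last by exists (n + m)%N.
  rewrite exprD hn gm /=.
  have -> : (h + c * y) * (g + d * z)
    = ((g + d * z) * h + (c * y) * g) + (c * d) * (y * z) by ring.
  by apply: (MD); [apply: MD|]; apply: MM.
exists (MkSpec MP); split => //= Mx; apply: (nMD _ Mx); by exists 1%N.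
Qed.

Lemma in_every_prime_nilpotent (x : R) :
  (forall P, Spec_set P x) -> exists n, x ^+ n = 0.
Proof.
move=> Px; apply: contrapT => /forallNP xn.
have [||P [_ nPx]] := @prime_avoiding_powers [set 0] x; last exact: nPx (Px P).
- split => //=; first by move=> y z -> ->; rewrite addr0.
  by move=> c y ->; rewrite mulr0.
- by move=> n; apply: xn.
Qed.

Lemma in_no_prime_1 I :
  submodule idfun I -> (forall P, ~ I `<=` Spec_set P) -> I 1.
Proof.
move=> idI IP; apply: contrapT => I1.
have [n|P [/IP//]] := @prime_avoiding_powers I 1 idI.
by rewrite expr1n.
Qed.

Lemma Spec_idempotent P (e : R) : e * e = e -> Spec_set P e \/ Spec_set P (1 - e).
Proof.
have [P0 _ _ _ Pp] := SpecP P.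
by move=> ee; apply: Pp; rewrite mulrBr mulr1 ee subrr.
Qed.

Lemma Spec_not_both P (x y : R) : x + y = 1 -> Spec_set P x -> ~ Spec_set P y.
Proof.
have [_ PD _ P1 _] := SpecP P.
by move=> xy Px Py; apply: P1; rewrite -xy; apply: PD.
Qed.

(** Where [e] does not vanish, [1 - e] does: the product [e' * (1 - e)] is in
every prime, so it is nilpotent; being idempotent, it is zero. *)
Lemma idempotent_zero_locus_le (e e' : R) : e * e = e -> e' * e' = e' ->
  zero_locus [set e] `<=` zero_locus [set e'] -> e' = e' * e.
Proof.
move=> ee ee' ZZ; suff : e' * (1 - e) = 0.
  by rewrite mulrBr mulr1 => /eqP; rewrite subr_eq0 => /eqP.
have [P|n xn] := @in_every_prime_nilpotent (e' * (1 - e)).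
  have [_ _ PM _ _] := SpecP P.
  have [Pe|Pe] := Spec_idempotent P ee; last exact: PM.
  by rewrite mulrC; apply: PM; apply: (ZZ P) => [_ ->|].
have xx : e' * (1 - e) * (e' * (1 - e)) = e' * (1 - e).
  have -> : e' * (1 - e) * (e' * (1 - e))
    = (e' * e') * (1 - e - e + e * e) by ring.
  by rewrite ee ee'; ring.
move: xn xx; set x := e' * _ => xn xx; have xE m : x ^+ m.+1 = x.
  by elim: m => [|m IH]; rewrite ?expr1 // exprS IH.
by rewrite -(xE n) exprS xn mulr0.
Qed.

Lemma idempotent_zero_locus_inj (e e' : R) : e * e = e -> e' * e' = e' ->
  zero_locus [set e] = zero_locus [set e'] -> e = e'.
Proof.
move=> ee ee' ZZ; rewrite (idempotent_zero_locus_le ee' ee) ?ZZ //.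
by rewrite mulrC -idempotent_zero_locus_le ?ZZ.
Qed.

(** The vanishing ideals of [Z] and of its complement have no common prime, so
[1 = i + j] with [i * j] nilpotent. Replacing [i] and [j] by multiples of high
powers makes the product zero, which turns the two summands into idempotents. *)
Lemma clopen_zero_locus Z : closed Z -> closed (~` Z) ->
  exists e, e * e = e /\ Z = zero_locus [set e].
Proof.
rewrite -!openC => -[S ZS] [T ZT]; rewrite setCK in ZS; rewrite setCK in ZT.
pose van (Y : set (Spec R)) := [set x : R | forall P, Y P -> Spec_set P x].
pose I := [set x + y | x in van Z & y in van (~` Z)].
have vanA Y x y : van Y x -> van Y y -> van Y (x + y).
  move=> Yx Yy P YP; have [_ PD _ _ _] := SpecP P.
  by apply: PD; [apply: Yx|apply: Yy].
have vanM Y x y : van Y y -> van Y (x * y).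
  by move=> Yy P YP; have [_ _ PM _ _] := SpecP P; apply: PM; apply: Yy.
have van0 Y : van Y 0 by move=> P _; have [] := SpecP P.
have [||i vi [j vj ij]] := @in_no_prime_1 I.
- split; first by exists 0 => //; exists 0 => //; rewrite addr0.
  + move=> _ _ [x vx [y vy <-]] [x' vx' [y' vy' <-]].
    exists (x + x'); first exact: vanA.
    by exists (y + y'); [exact: vanA|ring].
  + move=> c _ [x vx [y vy <-]]; exists (c * x); first exact: vanM.
    by exists (c * y); [exact: vanM|rewrite /= mulrDr].
- move=> P IP; suff : ~ Z P /\ Z P by case.
  split.
  + apply: (_ : (~` Z) P); rewrite ZT => x Tx; apply: IP.
    exists 0; first exact: van0.
    by exists x; rewrite ?add0r // => Q; rewrite ZT; apply.
  + rewrite ZS => x Sx; apply: IP.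
    exists x; first by move=> Q; rewrite ZS; apply.
    by exists 0; [exact: van0|rewrite addr0].
have [P|n ijn] := @in_every_prime_nilpotent (i * j).
  have [_ _ PM _ _] := SpecP P.
  have [ZP|ZP] := pselect (Z P); last by apply: PM; apply: vj.
  by rewrite mulrC; apply: PM; apply: vi.
(* Comaximality survives powers: no prime contains both powers. *)
pose J := [set x * i ^+ n.+1 + y * j ^+ n.+1 | x in [set: R] & y in [set: R]].
have Ppow P (x : R) m : Spec_set P (x ^+ m) -> Spec_set P x.
  have [_ _ _ P1 Pp] := SpecP P.
  by elim: m => [|m IH]; [rewrite expr0 => /P1|rewrite exprS => /Pp[|/IH]].
have [||a _ [b _ ab]] := @in_no_prime_1 J.
- split; first by exists 0 => //; exists 0 => //; ring.
  + move=> _ _ [x _ [y _ <-]] [x' _ [y' _ <-]].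
    by exists (x + x') => //; exists (y + y') => //; ring.
  + move=> c _ [x _ [y _ <-]].
    by exists (c * x) => //; exists (c * y) => //=; ring.
- move=> P JP; apply: (@Spec_not_both P i j) => //; apply: (@Ppow P _ n.+1);
    apply: JP.
    by exists 1 => //; exists 0 => //; ring.
  by exists 0 => //; exists 1 => //; ring.
exists (a * i ^+ n.+1); split.
  have {2}-> : a * i ^+ n.+1 = 1 - b * j ^+ n.+1 by rewrite -ab; ring.
  have -> : a * i ^+ n.+1 * (1 - b * j ^+ n.+1)
    = a * i ^+ n.+1 - a * b * ((i * j) ^+ n * (i * j))
    by rewrite exprMn_comm; [rewrite !exprSr; ring|exact: mulrC].
  by rewrite ijn mul0r mulr0 subr0.
apply/seteqP; split => P.
  move=> ZP _ ->; have [_ _ PM _ _] := SpecP P.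
  by rewrite exprSr mulrA; apply: PM; apply: vi.
move=> /(_ _ erefl) Pe; apply: contrapT => ZP.
apply: (Spec_not_both ab Pe); have [_ _ PM _ _] := SpecP P.
by rewrite exprSr mulrA; apply: PM; apply: vj.
Qed.

End Spectrum.

(** The zero locus of [sigma e] is the preimage of that of [e]; it is the same
set when the set and its complement are both stable. *)
Lemma sigma_clopen_zero_locus (A : diffRingType)
    (Z : set (sigma_space (@Spec_sigma A))) :
  clopen Z ->
  exists e : A, [/\ e * e = e, sigma e = e & Z = zero_locus [set e]].
Proof.
move=> [/open_closedC/closed_sigma_spaceE[cZ' sZ'] /closed_sigma_spaceE[cZ sZ]].
have [e [ee Ze]] := clopen_zero_locus cZ cZ'.
exists e; split => //; apply: idempotent_zero_locus_inj => //.
  by rewrite -rmorphM ee.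
rewrite -Ze; apply/seteqP; split => P.
  move=> /(_ _ erefl) Pe; apply: contrapT => ZP.
  apply: (_ : (~` Z) (Spec_sigma P)); first by apply: sZ'; exists P.
  by rewrite Ze => _ ->.
move=> ZP _ ->; suff : Z (Spec_sigma P) by rewrite Ze; apply.
by apply: sZ; exists P.
Qed.

(** * Spaces with finitely many clopen subsets *)

Lemma finite_subsets (T : choiceType) (D : set T) :
  finite_set D -> finite_set [set F | F `<=` D].
Proof.
move=> /finite_seqP[s ->].
apply: (@sub_finite_set _ _
  (range (fun m : (size s).-tuple bool => [set` mask m s]))).
  move=> F Fs; exists [tuple of [seq `[< F u >] | u <- in_tuple s]] => //=.
  rewrite -filter_mask; apply/seteqP; split => x /=; rewrite mem_filter.
    by move=> /andP[/asboolP].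
  by move=> Fx; rewrite (Fs _ Fx) andbT; apply/asboolP.
exact/finite_image/finite_finset.
Qed.

(** The intersection of the clopen sets containing [x] is a finite intersection,
hence clopen itself, hence connected; so it is the component of [x], and a
component is determined by a set of clopen sets. *)
Lemma finite_clopen_components (X : topologicalType) :
  finite_set (@clopen X) ->
  finite_set (range (connected_component [set: X])).
Proof.
move=> fin; pose near (x : X) := [set U | clopen U /\ U x].
have fnear x : finite_set (near x) by apply: sub_finite_set fin => U [].
pose quasi (x : X) := \bigcap_(U in near x) U.
have quasix x : quasi x x by move=> U [].
have cquasi x : clopen (quasi x).
  split; last by apply: closed_bigI => U [[]].
  have [s sE] := (finite_seqP _).1 (fnear x).
  rewrite /quasi sE bigcap_seq big_seq; apply: big_rec => [|U V].
    exact: openT.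
  move=> Us oV; apply: openI => //.
  have : near x U by rewrite sE.
  by case=> -[].
have quasi_comp x : connected_component setT x = quasi x.
  apply/seteqP; split.
    move=> y [B [Bx _ Bcon] By] U [[oU cU] Ux].
    suff : B `&` U = B by move=> BU; move: By; rewrite -BU => -[].
    by apply: Bcon; [exists x|exists U|exists U].
  apply: connected_component_max => // B [b Bb] [C oC BC] [D cD BD].
  have [oQ cQ] := cquasi x.
  have clB : clopen B.
    by split; [rewrite BC; apply: openI|rewrite BD; apply: closedI].
  have BQ : B `<=` quasi x by rewrite BC; apply: subIset; left.
  apply/seteqP; split => // y Qy; apply: contrapT => nBy.
  have [Bx|nBx] := pselect (B x).
    by apply: nBy; apply: Qy.
  have nearB : near x (~` B) by split => //; apply: (@clopenC _ B B).
  exact: (BQ _ Bb _ nearB).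
apply: (@sub_finite_set _ _
  ((fun F => \bigcap_(U in F) U) @` [set F | F `<=` @clopen X])).
  move=> _ [x _ <-]; rewrite quasi_comp; exists (near x) => // U [] //.
exact/finite_image/finite_subsets.
Qed.

(** * Commutative rings of operators *)

(** The ring [operator G] below is the bicommutant of a set [G] of pairwise
commuting additive maps. Members of [G] commute with [G], so every element of
the bicommutant commutes with [G], and is therefore one of the maps that
elements of the bicommutant have to commute with: the ring is commutative. *)
Record commuting_family (W : zmodType) := CommutingFamily {
  family_set : set (W -> W);
  familyB : forall g, family_set g -> {morph g : w w' / w - w'};
  familyC : forall g h, family_set g -> family_set h -> g \o h =1 h \o g
}.

Section Bicommutant.
Variables (W : zmodType) (G : commuting_family W).

Definition commutes_with_family (f : W -> W) : Prop :=
  forall g, family_set G g -> f \o g =1 g \o f.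

Definition bicommutant : {pred W -> W} := mem [set f : W -> W |
  {morph f : w w' / w - w'} /\
  forall g, {morph g : w w' / w - w'} -> commutes_with_family g ->
    f \o g =1 g \o f].

Lemma bicommutantP f : reflect
  ({morph f : w w' / w - w'} /\
  forall g, {morph g : w w' / w - w'} -> commutes_with_family g ->
    f \o g =1 g \o f)
  (f \in bicommutant).
Proof. by apply: (iffP idP) => [/set_mem//|]; apply: mem_set. Qed.

Lemma morphB0 (f : W -> W) : {morph f : w w' / w - w'} -> f 0 = 0.
Proof. by move=> fB; rewrite -[in LHS](subrr 0) fB subrr. Qed.

Fact bicommutant_zmod_closed : zmod_closed bicommutant.
Proof.
split=> [|f h /bicommutantP[fB fC] /bicommutantP[hB hC]]; apply/bicommutantP.
  by split=> [w w'|g gB _ w] /=; rewrite ?subr0 // morphB0.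
split=> [w w'|g gB gG w].
  rewrite !fctE fB hB !opprB addrACA [in RHS]addrACA.
  by congr (_ + _); rewrite addrC.
have := fC g gB gG w; have := hC g gB gG w.
by rewrite !fctE /= => -> ->; rewrite gB.
Qed.

HB.instance Definition _ :=
  GRing.isZmodClosed.Build _ bicommutant bicommutant_zmod_closed.

Definition operator := {f : W -> W | f \in bicommutant}.
HB.instance Definition _ := SubType.on operator.
HB.instance Definition _ := Choice.on operator.
HB.instance Definition _ := [SubChoice_isSubZmodule of operator by <:].

Fact operator_id_subproof : idfun \in bicommutant.
Proof. by apply/bicommutantP. Qed.

Fact operator_comp_subproof (f h : operator) : val f \o val h \in bicommutant.
Proof.
case: f h => [f /= /bicommutantP[fB fC]] [h /= /bicommutantP[hB hC]].
apply/bicommutantP; split=> [w w'|g gB gG w] /=; first by rewrite hB fB.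
have := hC g gB gG w; rewrite /= => ->.
by have := fC g gB gG (h w); rewrite /= => ->.
Qed.

Lemma family_bicommutant g : family_set G g -> g \in bicommutant.
Proof.
move=> Gg; apply/bicommutantP; split=> [|h hB hG w]; first exact: familyB Gg.
by rewrite (hG g Gg w).
Qed.

Definition operator_id : operator := Sub idfun operator_id_subproof.
Definition operator_comp f h : operator :=
  Sub (val f \o val h) (operator_comp_subproof f h).

Fact operator_compA : associative operator_comp.
Proof. by move=> f g h; exact: val_inj. Qed.
Fact operator_compC : commutative operator_comp.
Proof.
case=> [f fG] [h hG]; apply: val_inj; apply/funext => w /=.
have [hB hC] := bicommutantP _ hG; have [_ fC] := bicommutantP _ fG.
apply: fC => // g Gg; apply: hC; first exact: familyB Gg.
by move=> k Gk z; exact: (familyC Gg Gk z).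
Qed.
Fact operator_id_comp : left_id operator_id operator_comp.
Proof. by move=> f; exact: val_inj. Qed.
Fact operator_compDl : left_distributive operator_comp +%R.
Proof. by move=> f g h; exact: val_inj. Qed.

HB.instance Definition _ := GRing.Zmodule_isComPzRing.Build operator
  operator_compA operator_compC operator_id_comp operator_compDl.

End Bicommutant.

(** * Amalgamation over a field *)

(** For C-algebras [A] and [B] with idempotents [u] and [v], the ring [amalgam]
stands for the tensor product over [C] of the factor of [A] where [u = 1] and
the factor of [B] where [v = 1]. It is realized by operators on the module of
C-linear maps from the second factor to the first one, on which [A] acts by
multiplying values and [B] by multiplying arguments. The relations are then
immediate, and the ring is nonzero as soon as one nonzero such map exists. *)
Section Amalgam.
Variables (C A B : comPzRingType).
Variables (a : {rmorphism C -> A}) (b : {rmorphism C -> B}).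
Variables (u : A) (v : B).

Definition balanced : {pred B -> A} := mem [set w : B -> A |
  [/\ forall x y, w (x - y) = w x - w y, forall c y, w (b c * y) = a c * w y,
      forall y, u * w y = w y & forall y, w (v * y) = w y]].

Lemma balancedP w : reflect
  [/\ forall x y, w (x - y) = w x - w y, forall c y, w (b c * y) = a c * w y,
      forall y, u * w y = w y & forall y, w (v * y) = w y] (w \in balanced).
Proof. by apply: (iffP idP) => [/set_mem//|]; apply: mem_set. Qed.

Fact balanced_zmod_closed : zmod_closed balanced.
Proof.
split=> [|f g /balancedP[f1 f2 f3 f4] /balancedP[g1 g2 g3 g4]]; apply/balancedP.
  by split=> * /=; rewrite ?subr0 ?mulr0.
split=> * /=; rewrite !fctE /= ?f1 ?g1 ?f2 ?g2 ?f4 ?g4 ?mulrBr ?f3 ?g3 //.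
by ring.
Qed.

HB.instance Definition _ := GRing.isZmodClosed.Build _ balanced balanced_zmod_closed.

Definition balanced_map := {w : B -> A | w \in balanced}.
HB.instance Definition _ := SubType.on balanced_map.
HB.instance Definition _ := Choice.on balanced_map.
HB.instance Definition _ := [SubChoice_isSubZmodule of balanced_map by <:].

Fact mull_subproof (x : A) (w : balanced_map) : (fun y => x * val w y) \in balanced.
Proof.
case: w => w /= /balancedP[w1 w2 w3 w4]; apply/balancedP; split=> *.
- by rewrite w1 mulrBr.
- by rewrite w2 mulrCA.
- by rewrite mulrCA w3.
- by rewrite w4.
Qed.

Fact mulr_subproof (x : B) (w : balanced_map) : (fun y => val w (x * y)) \in balanced.
Proof.
case: w => w /= /balancedP[w1 w2 w3 w4]; apply/balancedP; split=> *.
- by rewrite mulrBr w1.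
- by rewrite mulrCA w2.
- by rewrite w3.
- by rewrite mulrCA w4.
Qed.

Definition mull x w : balanced_map :=
  Sub (fun y => x * val w y) (mull_subproof x w).
Definition mulr x w : balanced_map :=
  Sub (fun y => val w (x * y)) (mulr_subproof x w).

Definition multiplication : set (balanced_map -> balanced_map) :=
  range mull `|` range mulr.

Fact multiplicationB g : multiplication g -> {morph g : w w' / w - w'}.
Proof.
case=> -[x _ <-] w w'; apply: val_inj; apply/funext => y //=.
by rewrite !fctE /= mulrBr.
Qed.

Fact multiplicationC g h :
  multiplication g -> multiplication h -> g \o h =1 h \o g.
Proof.
by case=> -[x _ <-]; case=> -[y _ <-] w; apply: val_inj; apply/funext => z //=;
  rewrite mulrCA.
Qed.

Definition amalgam := operator (CommutingFamily multiplicationB multiplicationC).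
HB.instance Definition _ := GRing.ComPzRing.on amalgam.

Definition amalgam_l (x : A) : amalgam :=
  Sub (mull x) (@family_bicommutant _
    (CommutingFamily multiplicationB multiplicationC) _
    (or_introl (ex_intro2 _ _ x Logic.I erefl))).
Definition amalgam_r (x : B) : amalgam :=
  Sub (mulr x) (@family_bicommutant _
    (CommutingFamily multiplicationB multiplicationC) _
    (or_intror (ex_intro2 _ _ x Logic.I erefl))).

Lemma amalgam_ext (f g : amalgam) :
  (forall w y, val (val f w) y = val (val g w) y) -> f = g.
Proof.
move=> fg; apply: val_inj; apply/funext => w.
by apply: val_inj; apply/funext => y.
Qed.

Fact amalgam_l_zmod : zmod_morphism amalgam_l.
Proof. by move=> x y; apply: amalgam_ext => w z /=; rewrite mulrBl. Qed.

Fact amalgam_l_monoid : monoid_morphism amalgam_l.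
Proof.
by split=> [|x y]; apply: amalgam_ext => w z /=; rewrite ?mul1r -?mulrA.
Qed.

Fact amalgam_r_zmod : zmod_morphism amalgam_r.
Proof.
move=> x y; apply: amalgam_ext => w z /=; rewrite mulrBl.
by have [-> _ _ _] := balancedP _ (valP w).
Qed.

Fact amalgam_r_monoid : monoid_morphism amalgam_r.
Proof.
split=> [|x y]; apply: amalgam_ext => w z /=; rewrite ?mul1r //.
by rewrite -mulrA mulrCA.
Qed.

HB.instance Definition _ := GRing.isZmodMorphism.Build _ _ amalgam_l amalgam_l_zmod.
HB.instance Definition _ := GRing.isMonoidMorphism.Build _ _ amalgam_l amalgam_l_monoid.
HB.instance Definition _ := GRing.isZmodMorphism.Build _ _ amalgam_r amalgam_r_zmod.
HB.instance Definition _ := GRing.isMonoidMorphism.Build _ _ amalgam_r amalgam_r_monoid.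

Lemma amalgam_lr (x : C) : amalgam_l (a x) = amalgam_r (b x).
Proof.
by apply: amalgam_ext => w z /=; have [_ -> _ _] := balancedP _ (valP w).
Qed.

Lemma amalgam_l1 : amalgam_l u = 1.
Proof.
by apply: amalgam_ext => w z /=; have [_ _ -> _] := balancedP _ (valP w).
Qed.

Lemma amalgam_r1 : amalgam_r v = 1.
Proof.
by apply: amalgam_ext => w z /=; have [_ _ _ ->] := balancedP _ (valP w).
Qed.

Lemma amalgam_neq0 (w : B -> A) y : w \in balanced -> w y <> 0 -> (1 : amalgam) <> 0.
Proof.
move=> bw wy one0; apply: wy.
by have /(congr1 (fun f : amalgam => val (val f (Sub w bw)) y)) := one0.
Qed.

End Amalgam.

(** The ideal [eps * C] is zero or a field with unit [eps]. *)
Definition field_idempotent (C : comPzRingType) (eps : C) : Prop :=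
  eps * eps = eps /\ forall x, eps * x <> 0 -> exists y, y * x * eps = eps.

Section BalancedExists.
Variables (C A B : comPzRingType).
Variables (a : {rmorphism C -> A}) (b : {rmorphism C -> B}).
Variables (eps : C) (u : A) (v : B).
Hypotheses (field_eps : field_idempotent eps) (uu : u * u = u) (vv : v * v = v).

(** With [F] the field [eps * C], the element [eta] is a nonzero vector of the
F-vector space [eta * B]. A maximal submodule [M] of [B] avoiding [eta] meets
that space in a complement of the line of [eta], so every [eta * y] is congruent
modulo [M] to [b c * eta] for a scalar [c] that is unique in [F]; the linear map
sends [y] to [a c * (u * a eps)]. *)
Lemma balanced_exists : u * a eps <> 0 -> v * b eps <> 0 ->
  exists w y, w \in balanced a b u v /\ w y <> 0.
Proof.
move=> ua0; set eta := v * b eps => eta0.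
have [ee fe] := field_eps.
have [||M [[M0 MD MM] kM Mdis Mmax]] :=
  @maximal_submodule C B b [set y | eta * y = 0] [set eta].
- split=> /= [|x y xE yE|c x xE]; first by rewrite mulr0.
    by rewrite mulrDr xE yE addr0.
  by rewrite mulrCA xE mulr0.
- rewrite -subset0 => y [/= + yE]; rewrite yE.
  by rewrite /eta mulrACA vv -rmorphM ee => /eta0.
have Meta : ~ M eta by move=> Me; rewrite -[False]/(set0 eta) -Mdis.
have MN x : M x -> M (- x).
  by move=> Mx; rewrite -mulN1r -(rmorph1 b) -rmorphN; apply: MM.
have MB x y : M x -> M y -> M (x - y) by move=> Mx /MN; apply: MD.
have coord y : exists c, M (eta * y - b c * eta).
  have [My|/Mmax[c [h [Mh hc]]]] := pselect (M (eta * y)).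
    by exists 0; rewrite rmorph0 mul0r subr0.
  have ce : eps * c <> 0.
    move=> ce0; apply: Meta; rewrite -hc mulrA (mulrC (b c)) /eta.
    by rewrite -(mulrA v) -rmorphM ce0 rmorph0 mulr0 mul0r addr0.
  have [d dE] := fe _ ce; exists d.
  suff -> : eta * y - b d * eta = - (b d * h) by apply/MN/MM.
  have E : b d * b c * (eta * y) = eta * y.
    by rewrite -rmorphM /eta -[in RHS]dE rmorphM; ring.
  rewrite -[X in _ - _ * X]hc mulrDr opprD [b d * (_ * _)]mulrA E; ring.
have [k kE] := choice coord.
have coord0 c : M (b c * eta) -> a c * (u * a eps) = 0.
  move=> Mc; have [ec|/fe[d dE]] := pselect (eps * c = 0).
    by rewrite mulrCA -rmorphM mulrC (mulrC c) ec rmorph0 mul0r.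
  case: Meta; have := MM d _ Mc; rewrite mulrA -rmorphM /eta mulrCA -rmorphM.
  by rewrite dE.
pose w y := a (k y) * (u * a eps).
have wE y c : M (eta * y - b c * eta) -> w y = a c * (u * a eps).
  move=> Mc; apply/eqP; rewrite -subr_eq0 /w -mulrBl -rmorphB; apply/eqP.
  apply: coord0; have := MB _ _ Mc (kE y); rewrite rmorphB.
  by congr M; ring.
exists w, 1; split.
  apply/balancedP; split.
  - move=> x y; rewrite /w -mulrBl -rmorphB; apply: wE.
    by have := MB _ _ (kE x) (kE y); rewrite rmorphB; congr M; ring.
  - move=> c y; rewrite {2}/w [a c * _]mulrA -rmorphM; apply: wE.
    by have := MM c _ (kE y); rewrite rmorphM; congr M; ring.
  - by move=> y; rewrite /w mulrCA (mulrA u) uu.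
  - move=> y; apply: wE; have -> // : eta * (v * y) = eta * y.
    by rewrite /eta -[in RHS]vv; ring.
rewrite (@wE 1 1); first by rewrite rmorph1 mul1r.
by rewrite rmorph1 mul1r mulr1 subrr.
Qed.

(** Two extensions of a field have a nonzero common extension. *)
Lemma amalgamation : u * a eps <> 0 -> v * b eps <> 0 ->
  exists (Om : comPzRingType) (f : {rmorphism A -> Om}) (g : {rmorphism B -> Om}),
    [/\ forall x, f (a x) = g (b x), f u = 1, g v = 1 & (1 : Om) <> 0].
Proof.
move=> ua vb; have [w [y [bw wy]]] := balanced_exists ua vb.
exists (amalgam a b u v), (@amalgam_l _ _ _ a b u v), (@amalgam_r _ _ _ a b u v).
split; [exact: amalgam_lr|exact: amalgam_l1|exact: amalgam_r1|].
exact: amalgam_neq0 bw wy.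
Qed.

End BalancedExists.

(** * Universal points *)

Lemma rmorphism_ext (R S : pzSemiRingType) (f g : {rmorphism R -> S}) :
  f =1 g -> f = g.
Proof.
move: f g => [f [[fD] [fM]]] [g [[gD] [gM]]] /= /funext fg.
by move: fg gD gM => <- gD gM;
  rewrite (Prop_irrelevance fD gD) (Prop_irrelevance fM gM).
Qed.

Lemma algHom_ext (k : comPzRingType) (A B : algebra k) (f g : algHom A B) :
  f =1 g -> f = g.
Proof.
move: f g => [f fP] [g gP] /= /rmorphism_ext fg.
by move: fg gP => <- gP; rewrite (Prop_irrelevance fP gP).
Qed.

Lemma diffAlgHom_ext (k : diffRingType) (A B : diffAlgebra k)
  (f g : diffAlgHom A B) : f =1 g -> f = g.
Proof.
move: f g => [f fP] [g gP] /= fg; have {}fg : f = g by apply: algHom_ext.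
by move: fg gP => <- gP; rewrite (Prop_irrelevance fP gP).
Qed.

Lemma coc_points_ext (k : diffRingType) (A0 C0 : algebra k)
    (X : cocorrespondence A0 C0) (B : diffAlgebra k) (c d : coc_points X B) :
  c =1 d -> c = d.
Proof.
move: c d => [c cP] [d dP] /= cd; have {}cd : c = d by apply: algHom_ext.
by move: cd dP => <- dP; rewrite (Prop_irrelevance cP dP).
Qed.

Lemma diffAlgebraP (k : diffRingType) (A : diffAlgebra k) (x : k) :
  sigma (diffAlgebra_map A x) = diffAlgebra_map A (sigma x).
Proof. by case: A. Qed.

Definition diffAlgHom_id (k : diffRingType) (A : diffAlgebra k) : diffAlgHom A A :=
  @DiffAlgHom k A A (@AlgHom k (underlying A) (underlying A) idfun
    (fun x => erefl)) (fun a => erefl).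

(** The existence and uniqueness form of representability: by the Yoneda lemma,
the natural bijection is composition with the image of the identity. *)
Definition universal_point (k : diffRingType) (A0 C0 : algebra k)
    (X : cocorrespondence A0 C0) (A : diffAlgebra k) (c : coc_points X A) : Prop :=
  forall B : diffAlgebra k,
    (forall d : coc_points X B, exists h : diffAlgHom A B, forall x, h (c x) = d x) /\
    (forall f g : diffAlgHom A B, (forall x, f (c x) = g (c x)) -> f =1 g).

Lemma directly_presented_universal (k : diffRingType) (A0 C0 : algebra k)
    (X : cocorrespondence A0 C0) (A : diffAlgebra k) :
  directly_presented_by X A -> exists c : coc_points X A, universal_point c.
Proof.
move=> [phi [phi_bij phi_nat]]; pose c := phi A (diffAlgHom_id A); exists c => B.
have phiE (f : diffAlgHom A B) : phi B f = coc_points_map f c.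
  by rewrite -phi_nat; congr phi; apply: diffAlgHom_ext.
have [psi phiK psiK] := phi_bij B; split=> [d|f g fg x].
  by exists (psi d) => x; rewrite -[in RHS](psiK d) phiE.
suff -> : f = g by [].
by apply: (can_inj phiK); rewrite !phiE; apply: coc_points_ext => y; apply: fg.
Qed.

(** * Iterates of sigma *)

Definition sigmaN (R : diffRingType) (n : nat) : R -> R := iter n sigma.

Fact sigmaN_zmod (R : diffRingType) n : zmod_morphism (@sigmaN R n).
Proof. by move=> x y; elim: n => //= n ->; rewrite rmorphB. Qed.
Fact sigmaN_monoid (R : diffRingType) n : monoid_morphism (@sigmaN R n).
Proof.
by split; [elim: n => //= n ->; rewrite rmorph1
  |move=> x y; elim: n => //= n ->; rewrite rmorphM].
Qed.
HB.instance Definition _ (R : diffRingType) n :=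
  GRing.isZmodMorphism.Build R R (sigmaN n) (@sigmaN_zmod R n).
HB.instance Definition _ (R : diffRingType) n :=
  GRing.isMonoidMorphism.Build R R (sigmaN n) (@sigmaN_monoid R n).

Lemma sigmaN_fixed (R : diffRingType) n (x : R) : sigma x = x -> sigmaN n x = x.
Proof. by move=> xE; elim: n => //= n ->. Qed.

Lemma sigmaNS (R : diffRingType) n (x : R) : sigmaN n.+1 x = sigma (sigmaN n x).
Proof. by []. Qed.

Lemma sigmaNSr (R : diffRingType) n (x : R) : sigmaN n.+1 x = sigmaN n (sigma x).
Proof. exact: iterSr. Qed.

Lemma sigmaND (R : diffRingType) m n (x : R) :
  sigmaN (m + n) x = sigmaN m (sigmaN n x).
Proof. exact: iterD. Qed.

Lemma sigmaN_scalar (k : diffRingType) (A : diffAlgebra k) n (x : k) :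
  sigmaN n (diffAlgebra_map A x) = diffAlgebra_map A (sigmaN n x).
Proof. by elim: n => // n IH; rewrite !sigmaNS IH diffAlgebraP. Qed.

(** * Difference subalgebras *)

Record diffSubalgebra (k : diffRingType) (A : diffAlgebra k) := DiffSubalgebra {
  diffSubalgebra_pred : {pred A};
  diffSubalgebra_ring : subring_closed diffSubalgebra_pred;
  diffSubalgebra_sigma :
    forall x, x \in diffSubalgebra_pred -> sigma x \in diffSubalgebra_pred;
  diffSubalgebra_scalar :
    forall x, diffAlgebra_map A x \in diffSubalgebra_pred
}.

Section DiffSubalgebra.
Variables (k : diffRingType) (A : diffAlgebra k) (S : diffSubalgebra A).

Definition subalgebra_type := {x : A | x \in diffSubalgebra_pred S}.
HB.instance Definition _ := SubType.on subalgebra_type.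
HB.instance Definition _ := Choice.on subalgebra_type.
HB.instance Definition _ := GRing.SubChoice_isSubComPzRing.Build A _
  subalgebra_type (diffSubalgebra_ring S).

Definition sub_sigma (x : subalgebra_type) : subalgebra_type :=
  Sub (sigma (val x)) (diffSubalgebra_sigma (valP x)).

Fact sub_sigma_zmod : zmod_morphism sub_sigma.
Proof. by move=> x y; apply: val_inj; rewrite /= !rmorphB. Qed.
Fact sub_sigma_monoid : monoid_morphism sub_sigma.
Proof.
by split=> [|x y]; apply: val_inj; rewrite /= ?rmorphM ?rmorph1.
Qed.
HB.instance Definition _ :=
  GRing.isZmodMorphism.Build _ _ sub_sigma sub_sigma_zmod.
HB.instance Definition _ :=
  GRing.isMonoidMorphism.Build _ _ sub_sigma sub_sigma_monoid.
HB.instance Definition _ := hasDifference.Build subalgebra_type sub_sigma.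

Definition sub_scalar (x : k) : subalgebra_type :=
  Sub (diffAlgebra_map A x) (diffSubalgebra_scalar S x).

Fact sub_scalar_zmod : zmod_morphism sub_scalar.
Proof. by move=> x y; apply: val_inj; rewrite /= !rmorphB. Qed.
Fact sub_scalar_monoid : monoid_morphism sub_scalar.
Proof.
by split=> [|x y]; apply: val_inj; rewrite /= ?rmorphM ?rmorph1.
Qed.
HB.instance Definition _ :=
  GRing.isZmodMorphism.Build _ _ sub_scalar sub_scalar_zmod.
HB.instance Definition _ :=
  GRing.isMonoidMorphism.Build _ _ sub_scalar sub_scalar_monoid.

Fact sub_scalarP (x : k) : sigma (sub_scalar x) = sub_scalar (sigma x).
Proof. by apply: val_inj; rewrite /= diffAlgebraP. Qed.

Definition subalgebra : diffAlgebra k :=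
  @DiffAlgebra k subalgebra_type sub_scalar sub_scalarP.

Definition subalgebra_incl : diffAlgHom subalgebra A :=
  @DiffAlgHom k subalgebra A
    (@AlgHom k (underlying subalgebra) (underlying A)
      (val : {rmorphism subalgebra_type -> A}) (fun x => erefl)) (fun x => erefl).

Section Points.
Variables (A0 C0 : algebra k) (X : cocorrespondence A0 C0) (c : coc_points X A).
Hypothesis cS : forall x, c x \in diffSubalgebra_pred S.

Definition sub_point_fun (x : C0) : subalgebra := Sub (c x) (cS x).

Fact sub_point_zmod : zmod_morphism sub_point_fun.
Proof. by move=> x y; apply: val_inj; rewrite /= !rmorphB. Qed.
Fact sub_point_monoid : monoid_morphism sub_point_fun.
Proof.
by split=> [|x y]; apply: val_inj; rewrite /= ?rmorphM ?rmorph1.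
Qed.
HB.instance Definition _ :=
  GRing.isZmodMorphism.Build _ _ sub_point_fun sub_point_zmod.
HB.instance Definition _ :=
  GRing.isMonoidMorphism.Build _ _ sub_point_fun sub_point_monoid.

Fact sub_point_scalar (x : k) :
  sub_point_fun (algebra_map C0 x) = algebra_map (underlying subalgebra) x.
Proof. by apply: val_inj; rewrite /= algHomP. Qed.

Fact sub_pointP (y : A0) :
  sigma (sub_point_fun (coc_p X y)) = sub_point_fun (coc_s X y).
Proof. by apply: val_inj; rewrite /= -coc_pointP. Qed.

Definition sub_point : coc_points X subalgebra :=
  @CocPoint k A0 C0 X subalgebra
    (@AlgHom k C0 (underlying subalgebra) sub_point_fun sub_point_scalar) sub_pointP.

(** The universal point factors through the subalgebra; the induced map from [A]
to the subalgebra, followed by the inclusion, fixes the universal point, so it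
is the identity. *)
Lemma universal_point_generates : universal_point c ->
  forall x, x \in diffSubalgebra_pred S.
Proof.
move=> cU x; have [/(_ sub_point)[r rE] _] := cU subalgebra.
have retract : diffAlgHom_comp subalgebra_incl r =1 diffAlgHom_id A.
  by apply: (cU A).2 => y /=; rewrite rE.
by have /= <- := retract x; apply: (valP (r x)).
Qed.

End Points.
End DiffSubalgebra.

(** * Sequences with the shift *)

(** Difference morphisms to the sequences in [R] correspond to ring morphisms to
[R] by taking the term of index 0: the shift is the cofree difference structure.
The structure map of the algebra of sequences is dictated by this. *)
Section Streams.
Variable R : comPzRingType.

Definition stream := nat -> R.
HB.instance Definition _ := GRing.ComPzRing.on stream.

Definition shift (s : stream) : stream := fun n => s n.+1.
Fact shift_zmod : zmod_morphism shift.
Proof. by []. Qed.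
Fact shift_monoid : monoid_morphism shift.
Proof. by []. Qed.
HB.instance Definition _ := GRing.isZmodMorphism.Build stream stream shift shift_zmod.
HB.instance Definition _ := GRing.isMonoidMorphism.Build stream stream shift shift_monoid.
HB.instance Definition _ := hasDifference.Build stream shift.

Section StreamAlgebra.
Variables (k : diffRingType) (g : {rmorphism k -> R}).

Definition stream_scalar (x : k) : stream := fun n => g (sigmaN n x).

Fact stream_scalar_zmod : zmod_morphism stream_scalar.
Proof. by move=> x y; apply/funext => n; rewrite /stream_scalar !rmorphB. Qed.
Fact stream_scalar_monoid : monoid_morphism stream_scalar.
Proof.
by split=> [|x y]; apply/funext => n; rewrite /stream_scalar ?rmorph1 ?rmorphM.
Qed.
HB.instance Definition _ :=
  GRing.isZmodMorphism.Build _ _ stream_scalar stream_scalar_zmod.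
HB.instance Definition _ :=
  GRing.isMonoidMorphism.Build _ _ stream_scalar stream_scalar_monoid.

Fact stream_scalarP (x : k) : sigma (stream_scalar x) = stream_scalar (sigma x).
Proof. by apply/funext => n; rewrite /stream_scalar -sigmaNSr. Qed.

Definition stream_algebra : diffAlgebra k :=
  @DiffAlgebra k stream stream_scalar stream_scalarP.

End StreamAlgebra.
End Streams.

(** * Gluing two morphisms along an edge *)

Section Levels.
Variables (k : diffRingType) (A0 C0 : algebra k) (X : cocorrespondence A0 C0).
Variables (A : diffAlgebra k) (c : coc_points X A).

(** The subring generated by the scalars and the first [N + 1] translates of the
universal point: functions of the first [N + 1] edges of a path. *)
Inductive level (N : nat) : A -> Prop :=
| level_scalar x : level N (diffAlgebra_map A x)
| level_point m x : (m <= N)%N -> level N (sigmaN m (c x))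
| level_sub x y : level N x -> level N y -> level N (x - y)
| level_mul x y : level N x -> level N y -> level N (x * y).

Lemma level_mono N N' x : (N <= N')%N -> level N x -> level N' x.
Proof.
move=> NN'; elim=> {x} [x|m x mN|x y _ IHx _ IHy|x y _ IHx _ IHy].
- exact: level_scalar.
- exact/level_point/(leq_trans mN).
- exact: level_sub.
- exact: level_mul.
Qed.

Lemma level_sigma N x : level N x -> level N.+1 (sigma x).
Proof.
elim=> {x} [x|m x mN|x y _ IHx _ IHy|x y _ IHx _ IHy].
- rewrite diffAlgebraP; exact: level_scalar.
- rewrite -sigmaNS; exact: level_point.
- rewrite rmorphB; exact: level_sub.
- rewrite rmorphM; exact: level_mul.
Qed.

Definition reachable : {pred A} := mem [set x | exists N, level N x].

Lemma reachableP x : reflect (exists N, level N x) (x \in reachable).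
Proof. by apply: (iffP idP) => [/set_mem//|]; apply: mem_set. Qed.

Fact reachable_ring : subring_closed reachable.
Proof.
split=> [|x y /reachableP[N xN] /reachableP[M yM]
  |x y /reachableP[N xN] /reachableP[M yM]]; apply/reachableP.
- by exists 0%N; rewrite -(rmorph1 (diffAlgebra_map A)); apply: level_scalar.
- exists (maxn N M); apply: level_sub.
    exact: level_mono (leq_maxl _ _) xN.
  exact: level_mono (leq_maxr _ _) yM.
- exists (maxn N M); apply: level_mul.
    exact: level_mono (leq_maxl _ _) xN.
  exact: level_mono (leq_maxr _ _) yM.
Qed.

Fact reachable_sigma x : x \in reachable -> sigma x \in reachable.
Proof.
by move=> /reachableP[N xN]; apply/reachableP; exists N.+1; apply: level_sigma.
Qed.

Fact reachable_scalar x : diffAlgebra_map A x \in reachable.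
Proof. by apply/reachableP; exists 0%N; apply: level_scalar. Qed.

Hypothesis c_universal : universal_point c.

Lemma level_exhaustive x : exists N, level N x.
Proof.
pose S := DiffSubalgebra reachable_ring reachable_sigma reachable_scalar.
apply/reachableP; apply: (@universal_point_generates _ _ S _ _ _ c) => // y.
by apply/reachableP; exists 0%N; apply: (@level_point 0 0).
Qed.

Section Gluing.
Variables (R : comPzRingType) (N : nat) (f g : {rmorphism A -> R}).
Hypothesis fg : forall x : C0, f (sigmaN N (c x)) = g (c x).

(** The scalars act through [f]: the sequence starts with values of [f]. *)
Local Notation glued_streams :=
  (stream_algebra (f \o diffAlgebra_map A : {rmorphism k -> R})).

Definition glued_fun (x : C0) : glued_streams :=
  fun m => if (m < N)%N then f (sigmaN m (c x)) else g (sigmaN (m - N) (c x)).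

Lemma glued_leE x m : (m <= N)%N -> glued_fun x m = f (sigmaN m (c x)).
Proof.
rewrite /glued_fun leq_eqVlt => /orP[/eqP->|->] //.
by rewrite ltnn subnn -fg.
Qed.

Lemma glued_addE x m : glued_fun x (N + m) = g (sigmaN m (c x)).
Proof. by rewrite /glued_fun ltnNge leq_addr /= addKn. Qed.

Lemma glued_cases (P : nat -> Prop) :
  (forall m, (m < N)%N -> P m) -> (forall m, P (N + m)%N) -> forall m, P m.
Proof.
move=> Plt Pge m; case: (ltnP m N) => [/Plt//|/subnKC <-]; exact: Pge.
Qed.

Fact glued_zmod : zmod_morphism glued_fun.
Proof.
move=> x y; apply/funext => m; rewrite /glued_fun !fctE.
by case: ifP => _; rewrite !rmorphB.
Qed.
Fact glued_monoid : monoid_morphism glued_fun.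
Proof.
split=> [|x y]; apply/funext => m; rewrite /glued_fun !fctE.
  by case: ifP => _; rewrite !rmorph1.
by case: ifP => _; rewrite !rmorphM.
Qed.
HB.instance Definition _ := GRing.isZmodMorphism.Build _ _ glued_fun glued_zmod.
HB.instance Definition _ := GRing.isMonoidMorphism.Build _ _ glued_fun glued_monoid.

(** The twist of scalars by [sigma^N] on the second part of the sequence is
accounted for by the agreement of the two parts on the scalars of [C0]. *)
Lemma glue_scalar (x : k) m :
  f (diffAlgebra_map A (sigmaN (N + m) x)) = g (diffAlgebra_map A (sigmaN m x)).
Proof.
have cE y : c (algebra_map C0 y) = diffAlgebra_map A y by exact: algHomP.
by rewrite -[in RHS]cE -fg cE sigmaN_scalar sigmaND.
Qed.

Fact glued_algebra (x : k) : glued_fun (algebra_map C0 x) =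
  algebra_map (underlying glued_streams) x.
Proof.
have cE y : c (algebra_map C0 y) = diffAlgebra_map A y by exact: algHomP.
apply/funext => m; elim/glued_cases: m => m; rewrite /= /stream_scalar /=.
  by move=> mN; rewrite glued_leE ?(ltnW mN) // cE sigmaN_scalar.
by rewrite glued_addE cE sigmaN_scalar glue_scalar.
Qed.

Fact glued_pointP (y : A0) :
  sigma (glued_fun (coc_p X y)) = glued_fun (coc_s X y).
Proof.
apply/funext => m.
change (glued_fun (coc_p X y) m.+1 = glued_fun (coc_s X y) m).
elim/glued_cases: m => m; first move=> mN.
  by rewrite !glued_leE ?(ltnW mN) // sigmaNSr coc_pointP.
by rewrite -addnS !glued_addE sigmaNSr coc_pointP.
Qed.

Definition glued_point : coc_points X glued_streams :=
  @CocPoint k A0 C0 X _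
    (@AlgHom k C0 (underlying (stream_algebra _)) glued_fun glued_algebra)
    glued_pointP.

(** The map is the term of index 0 of the morphism induced by [glued_point]; the
term of index [N] is its composite with [sigma^N]. Both identities are checked
on the generators of the levels. *)
Lemma gluing : exists h : A -> R,
  [/\ {morph h : x y / x + y}, forall x, level N x -> h x = f x
    & forall x, h (sigmaN N x) = g x].
Proof.
have [/(_ glued_point)[h hE] _] := c_universal glued_streams.
have hN m x : h x m = h (sigmaN m x) 0%N.
  elim: m x => // m IH x; rewrite sigmaNSr -IH.
  by have := diffAlgHomP h x => ->.
have hc m x : h (sigmaN m (c x)) 0%N = glued_fun x m by rewrite -hN hE.
have hk x : h (diffAlgebra_map A x) 0%N = f (diffAlgebra_map A x).
  by have := algHomP h x => /= ->.
exists (fun x => h x 0%N); split=> [x y|x|x].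
- by rewrite rmorphD.
- elim=> {x} [x|m x mN|x y _ IHx _ IHy|x y _ IHx _ IHy].
  + exact: hk.
  + by rewrite hc glued_leE.
  + by rewrite !rmorphB -IHx -IHy.
  + by rewrite !rmorphM -IHx -IHy.
have [M] := level_exhaustive x.
elim=> {x} [x|m x mN|x y _ IHx _ IHy|x y _ IHx _ IHy].
- by rewrite sigmaN_scalar hk -[N]addn0 glue_scalar.
- by rewrite -sigmaND hc glued_addE.
- by rewrite !rmorphB -IHx -IHy.
- by rewrite !rmorphM -IHx -IHy.
Qed.

End Gluing.

(** Otherwise [f] and [g] from [amalgamation] could be glued to a map sending the
complementary elements [e] and [1 - e] both to [1]. *)
Lemma fixed_idempotent_dichotomy N (e : A) (eps : C0) :
  level N e -> e * e = e -> sigma e = e -> field_idempotent eps ->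
  e * sigmaN N (c eps) = 0 \/ (1 - e) * sigmaN N (c eps) = 0.
Proof.
move=> Ne ee se feps; apply: contrapT => /not_orP[e1 e2].
have e3 : (1 - e) * c eps <> 0.
  move=> e30; apply: e2; have : sigmaN N ((1 - e) * c eps) = 0.
    by rewrite e30 rmorph0.
  by rewrite rmorphM rmorphB rmorph1 /= (sigmaN_fixed N se).
have ee' : (1 - e) * (1 - e) = 1 - e.
  by rewrite mulrBr mulrBl mul1r mulr1 mulrBl ee mul1r; ring.
have [R [f [g [fg fe ge R1]]]] :=
  @amalgamation C0 A A (sigmaN N \o c : {rmorphism C0 -> A}) c eps e (1 - e)
    feps ee ee' e1 e3.
have [h [hD hf hg]] := gluing fg.
apply: R1; have he : h e = 1 by rewrite hf.
have he' : h (1 - e) = 1.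
  by rewrite -[RHS]ge -hg rmorphB rmorph1 /= sigmaN_fixed.
have h1 : h 1 = 1.
  rewrite hf ?rmorph1 // -(rmorph1 (diffAlgebra_map A)); exact: level_scalar.
have : (1 : R) + 1 = 1 by rewrite -{1}he -he' -hD addrC subrK h1 he'.
by move=> /(canRL (addrK _)); rewrite subrr.
Qed.

(** A fixed idempotent is recovered from the set of the [eps i] whose
translates it fixes. The exponent depends on [e], but an equation [e = sigma^N s] with [e] fixed
persists for larger exponents, so two fixed idempotents with the same set
can be compared. *)
Lemma finite_fixed_idempotents n (eps : 'I_n -> C0) :
  (forall i, field_idempotent (eps i)) -> \sum_i eps i = 1 ->
  finite_set [set e : A | e * e = e /\ sigma e = e].
Proof.
move=> feps eps1.
pose lifts (S : {set 'I_n}) := [set e : A | sigma e = e /\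
  exists N, e = sigmaN N (c (\sum_(i in S) eps i))].
apply: (@sub_finite_set _ _ (range (fun S => xget 0 (lifts S)))); last first.
  exact/finite_image/finite_finset.
move=> e [ee se]; have [N Ne] := level_exhaustive e.
pose S := [set i | `[< (1 - e) * sigmaN N (c (eps i)) = 0 >]]%SET.
have eS : lifts S e.
  split=> //; exists N.
  transitivity (e * sigmaN N (c (\sum_i eps i))).
    by rewrite eps1 !rmorph1 mulr1.
  rewrite !rmorph_sum mulr_sumr (bigID [in S]) /= [X in _ + X]big1 ?addr0.
    apply: eq_bigr => i; rewrite inE => /asboolP.
    by rewrite mulrBl mul1r => /eqP; rewrite subr_eq0 => /eqP.
  move=> i; rewrite inE => /asboolPn nS.
  by have [//|/nS] := fixed_idempotent_dichotomy Ne ee se (feps i).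
exists S => //=; have /= [sx [M xM]] := xgetI 0 eS.
have [_ [M' eM]] := eS.
rewrite -(sigmaN_fixed M' sx) xM -sigmaND addnC sigmaND -eM.
exact: sigmaN_fixed.
Qed.

End Levels.

(** * Idempotents of finite etale algebras *)

Lemma finite_etale_idempotents (k : fieldType) (E : algebra k) : finite_etale E ->
  exists n (eps : 'I_n -> E),
    (forall i, field_idempotent (eps i)) /\ \sum_i eps i = 1.
Proof.
move=> [n [L [f [_ _ [g fK gK]]]]]; exists n.
pose eps i := g (fun j => (i == j)%:R : L j); exists eps.
have fE h j : f j (g h) = h j by have /(congr1 (fun F => F j)) := gK h.
have f_inj x y : (forall j, f j x = f j y) -> x = y.
  by move=> xy; apply: (can_inj fK); apply/functional_extensionality_dep.
have feps i j : f j (eps i) = (i == j)%:R by rewrite fE.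
split=> [i|]; last first.
  apply: f_inj => j; rewrite rmorph_sum rmorph1 (bigD1 j) //= big1.
    by rewrite feps eqxx addr0.
  by move=> i ij; rewrite feps (negPf ij).
split=> [|x ex].
  by apply: f_inj => j; rewrite rmorphM feps; case: eqP; rewrite ?mulr1 ?mulr0.
have fx : f i x != 0.
  apply/eqP => fx; apply: ex; apply: f_inj => j; rewrite rmorphM feps rmorph0.
  by case: eqP => [<-|]; rewrite ?fx ?mulr0 ?mul0r.
exists (g (fun j => (f j x)^-1)); apply: f_inj => j.
rewrite !rmorphM feps fE; case: eqP => [<-|]; last by rewrite mulr0.
by rewrite mulVf // mulr1.
Qed.

Theorem proposition5p9 (k : diffFieldType) (A : diffAlgebra k)
  (hA : finitely_sigma_presented_etale A) :
  finite_set (sigma_components (@Spec_sigma A)).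
Proof.
have [A0 [C0 [X [_ /finite_etale_idempotents[n [eps [feps eps1]]]]]]] := hA.
move=> /directly_presented_universal[c cU].
apply: (@finite_clopen_components (sigma_space (@Spec_sigma A))).
apply: sub_finite_set (finite_image (fun e : A => zero_locus [set e])
  (finite_fixed_idempotents cU feps eps1)).
by move=> Z /sigma_clopen_zero_locus[e [ee se ->]]; exists e.
Qed.
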